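(* Let $d$ be prime, $n\ge1$, $G$ invertible over $\mathbb Z_d$, $\alpha\in[1/2,+\infty]$, and $\Lambda_1,\Lambda_2$ $n$-qudit channels. (1) If $G$ is odd-parity positive, $H_\alpha(\Lambda_1\boxtimes\Lambda_2)\ge H_\alpha(\Lambda_2)$. (2) If $G$ is even-parity positive, $H_\alpha(\Lambda_1\boxtimes\Lambda_2)\ge H_\alpha(\Lambda_1)$. (3) If $G$ is positive, $H_\alpha(\Lambda_1\boxtimes\Lambda_2)\ge\max\{H_\alpha(\Lambda_1),H_\alpha(\Lambda_2)\}$.
   Context: Fix a prime $d$. $G=\begin{pmatrix}g_{00}&g_{01}\\ g_{10}&g_{11}\end{pmatrix}$ over $\mathbb Z_d$, $\det G\not\equiv0$, $N=(\det G)^{-1}$; nontrivial if at most one entry is $0$ mod $d$; odd-parity positive if nontrivial and $g_{01},g_{10}\not\equiv0$; even-parity positive if nontrivial and $g_{00},g_{11}\not\equiv0$; positive if both. Key unitary on $(\mathbb C^d)^{\otimes n}\otimes(\mathbb C^d)^{\otimes n}$: $U|\vec i\rangle|\vec j\rangle=|Ng_{11}\vec i-Ng_{10}\vec j\rangle|-Ng_{01}\vec i+Ng_{00}\vec j\rangle$; $\mathcal E(\cdot)=\mathrm{Tr}_B[U(\cdot)U^\dagger]$, $\mathcal E^{-1}(\rho)=U^\dagger(\rho\otimes I_n/d^n)U$. The convolution of $n$-qudit channels is $\Lambda_1\boxtimes\Lambda_2=\mathcal E\circ(\Lambda_1\otimes\Lambda_2)\circ\mathcal E^{-1}$ (equivalently,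 the channel whose Choi state is the convolution of the Choi states). Let $\mathcal R(\rho)=\mathrm{Tr}[\rho]I_n/d^n$. With $D_\alpha$ the sandwiched Rényi relative entropy, $D_\alpha(\Lambda\|\mathcal R)=\sup_{\rho_{AR}}D_\alpha((\Lambda\otimes\mathrm{id}_R)(\rho_{AR})\|(\mathcal R\otimes\mathrm{id}_R)(\rho_{AR}))$ over all ancillas $R$, and $H_\alpha(\Lambda)=n\log d-D_\alpha(\Lambda\|\mathcal R)$. *)

(* Defs.v *)
From HB Require Import structures.
From mathcomp Require Import all_boot all_order all_algebra.
From mathcomp Require Import complex spectral.
From mathcomp Require Import boolp classical_sets reals constructive_ereal ereal exp.

Set Implicit Arguments.
Unset Strict Implicit.
Unset Printing Implicit Defensive.

Import Order.TTheory GRing.Theory Num.Theory.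
Local Open Scope ring_scope.

Section Quantum.
Variable R : realType.
Local Notation C := R[i].

(** Operators on the Hilbert space C^I (I a finite index set), stored as
    #|I| x #|I| complex matrices, entries addressed through enum_rank. *)
Definition op (I : finType) := 'M[C]_#|I|.

Definition ent (I : finType) (A : op I) (i j : I) : C :=
  A (enum_rank i) (enum_rank j).

Definition mkop (I : finType) (f : I -> I -> C) : op I :=
  \matrix_(a, b) f (enum_val a) (enum_val b).

Definition adj (I : finType) (A : op I) : op I := map_mx Num.conj (A ^T).

Definition psd (I : finType) (A : op I) : Prop :=
  adj A = A /\
  forall v : 'rV[C]_#|I|, 0 <= (v *m A *m map_mx Num.conj (v ^T)) 0 0.

Definition is_state (I : finType) (A : op I) : Prop := psd A /\ \tr A = 1.

(** Functional calculus of a Hermitian matrix via the spectral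
    decomposition A = P^-1 diag(lambda) P of MathComp's spectral.v
    (the eigenvalues of a Hermitian matrix are real). *)
Definition funmx (I : finType) (f : R -> R) (A : op I) : op I :=
  invmx (spectralmx A) *m
    diag_mx (map_mx (fun z : C => real_complex R (f (complex.Re z))) (spectral_diag A))
  *m spectralmx A.

(** x |-> x^p on (0,+oo), 0 elsewhere (powers on the support,
    i.e. generalized inverse for p < 0); x |-> ln x on the support. *)
Definition pw (p : R) (x : R) : R := if 0 < x then powR x p else 0.
Definition lnp (x : R) : R := if 0 < x then ln x else 0.

(** supp rho is contained in supp sigma, i.e. ker sigma <= ker rho. *)
Definition supp_le (I : finType) (rho sigma : op I) : Prop :=
  forall v : 'rV[C]_#|I|, v *m sigma = 0 -> v *m rho = 0.

(** Sandwiched Renyi relative entropy D_alpha(rho || sigma), alpha in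
    [1/2,1) u (1,+oo), together with its limits alpha = 1 (Umegaki relative
    entropy) and alpha = +oo (max-relative entropy).  Natural logarithm. *)
Definition sandwichedD (I : finType) (alpha : \bar R) (rho sigma : op I)
  : \bar R :=
  match alpha with
  | +oo%E =>
      ereal_inf [set (ln l)%:E | l in
                   [set l : R | 0 < l /\ psd (real_complex R l *: sigma - rho)]]
  | -oo%E => +oo%E
  | a%:E =>
      if a == 1 then
        (if `[< supp_le rho sigma >] then
           (complex.Re (\tr (rho *m (funmx lnp rho - funmx lnp sigma))))%:E
         else +oo%E)
      else
        let S := funmx (pw ((1 - a) / (2 * a))) sigma in
        let Q := complex.Re (\tr (funmx (pw a) (S *m rho *m S))) in
        if (1 < a) && ~~ `[< supp_le rho sigma >] then +oo%E
        else if Q <= 0 then +oo%E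
        else ((a - 1)^-1 * ln Q)%:E
  end.

(** (Lambda (x) id_K) and (id_I (x) Phi) acting on operators of I * K,
    defined blockwise (linear extension). *)
Definition liftL (I K : finType) (L : op I -> op I) (A : op (I * K)%type)
  : op (I * K)%type :=
  mkop (fun p q : (I * K)%type =>
          ent (L (mkop (fun i j : I => ent A (i, p.2) (j, q.2)))) p.1 q.1).

Definition liftR (I K : finType) (L : op K -> op K) (A : op (I * K)%type)
  : op (I * K)%type :=
  mkop (fun p q : (I * K)%type =>
          ent (L (mkop (fun k l : K => ent A (p.1, k) (q.1, l)))) p.2 q.2).

Definition channel (I : finType) (L : op I -> op I) : Prop :=
  [/\ forall (a : C) (A B : op I), L (a *: A + B) = a *: L A + L B,
      forall (k : nat) (A : op (I * 'I_k)%type), psd A -> psd (liftL L A)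
    & forall A : op I, \tr (L A) = \tr A].

Definition replacer (I : finType) (A : op I) : op I :=
  (\tr A / (#|I|%:R)) *: 1%:M.

Definition chanD (I : finType) (alpha : \bar R) (L M : op I -> op I)
  : \bar R :=
  ereal_sup [set x : \bar R | exists (k : nat) (rho : op (I * 'I_k)%type),
                is_state rho /\ x = sandwichedD alpha (liftL L rho) (liftL M rho)].

(** n-qudit systems: computational basis indexed by Z_d^n. *)
Definition qudits (d n : nat) : finType := 'rV['F_d]_n.

Definition chanH (d n : nat) (alpha : \bar R)
  (L : op (qudits d n) -> op (qudits d n)) : \bar R :=
  ((n%:R * ln (d%:R : R))%:E - chanD alpha L (@replacer (qudits d n)))%E.

Definition keymap (d n : nat) (G : 'M['F_d]_2) (q : (qudits d n * qudits d n)%type)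
  : (qudits d n * qudits d n)%type :=
  let N := (\det G)^-1 in
  ((N * G 1 1) *: q.1 - (N * G 1 0) *: q.2,
   - (N * G 0 1) *: q.1 + (N * G 0 0) *: q.2).

Definition keyU (d n : nat) (G : 'M['F_d]_2) : op (qudits d n * qudits d n)%type :=
  mkop (fun p q => if p == keymap G q then 1 else 0).

Definition kron (I J : finType) (A : op I) (B : op J) : op (I * J)%type :=
  mkop (fun p q : (I * J)%type => ent A p.1 q.1 * ent B p.2 q.2).

Definition ptraceR (I J : finType) (A : op (I * J)%type) : op I :=
  mkop (fun i j : I => \sum_(k : J) ent A (i, k) (j, k)).

Definition keyE (d n : nat) (G : 'M['F_d]_2)
  (X : op (qudits d n * qudits d n)%type) : op (qudits d n) :=
  ptraceR (@keyU d n G *m X *m adj (@keyU d n G)).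

Definition keyEinv (d n : nat) (G : 'M['F_d]_2) (rho : op (qudits d n))
  : op (qudits d n * qudits d n)%type :=
  adj (@keyU d n G) *m kron rho ((#|qudits d n|%:R)^-1 *: 1%:M) *m @keyU d n G.

Definition conv (d n : nat) (G : 'M['F_d]_2)
  (L1 L2 : op (qudits d n) -> op (qudits d n)) (rho : op (qudits d n))
  : op (qudits d n) :=
  keyE G (liftL L1 (liftR L2 (keyEinv G rho))).

End Quantum.

Definition nontrivialG (d : nat) (G : 'M['F_d]_2) : bool :=
  (#|[set ij : 'I_2 * 'I_2 | G ij.1 ij.2 == 0%R]| <= 1)%N.

Definition odd_parity_positive (d : nat) (G : 'M['F_d]_2) : bool :=
  [&& nontrivialG G, G 0 1 != 0 & G 1 0 != 0].

Definition even_parity_positive (d : nat) (G : 'M['F_d]_2) : bool :=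
  [&& nontrivialG G, G 0 0 != 0 & G 1 1 != 0].

Definition positiveG (d : nat) (G : 'M['F_d]_2) : bool :=
  odd_parity_positive G && even_parity_positive G.

(* Main.v *)
Require Import Defs.
From HB Require Import structures.
From mathcomp Require Import all_boot all_order all_algebra.
From mathcomp Require Import perm complex spectral.
From mathcomp Require Import boolp classical_sets reals constructive_ereal ereal exp.
From mathcomp Require Import ring lra.

(** Odd parity case; the even one reduces to it by exchanging the columns of G,
    which exchanges the two channels.  Write D = d^n.

    For a state rho on A R put omega = (E^-1 (x) id_R) rho on A B R.  Then
    (L1 [*] L2) rho = F (L2 omega) with F = E o (L1 (x) id_B), tensored with id_R,
    where L2 acts on B and A R is regarded as its ancilla.  Since g01 and g10 are
    nonzero, (i) the A R marginal of omega is 1/D (x) rho_R, so the reference state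
    (replacer (x) id) omega is 1/D^2 (x) rho_R, and (ii) F (1) = D . 1.

    Data processing under F is then elementary: F is linear over the operators
    on R, so the powers of the reference states pass through F, and the claim
    becomes tr f (F X) <= D^-1 tr f (D X) for convex f, which is Jensen's inequality
    for the transition weights between the spectra of X and F X.  No Lieb-type
    concavity is needed. *)

Set Implicit Arguments.
Unset Strict Implicit.
Unset Printing Implicit Defensive.

Import Order.TTheory GRing.Theory Num.Theory.
Local Open Scope ring_scope.

(** * Entrywise calculus for operators, and positive semidefiniteness *)

Section Entries.
Variable R : realType.
Local Notation C := R[i].
Implicit Types I J K : finType.

Lemma entP I (A B : op R I) : (forall i j, ent A i j = ent B i j) -> A = B.
Proof.
move=> AB; apply/matrixP => i j; have := AB (enum_val i) (enum_val j).
by rewrite /ent !enum_valK.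
Qed.

Lemma ent_mkop I (f : I -> I -> C) i j : ent (mkop f) i j = f i j.
Proof. by rewrite /ent mxE !enum_rankK. Qed.

Lemma sum_enum_val I (f : 'I_#|I| -> C) :
  \sum_i f i = \sum_(i : I) f (enum_rank i).
Proof.
rewrite (reindex (@enum_rank I)) //=.
by exists (@enum_val I predT) => i _; rewrite ?enum_rankK ?enum_valK.
Qed.

Lemma ent_mul I (A B : op R I) i j :
  ent (A *m B) i j = \sum_k ent A i k * ent B k j.
Proof. by rewrite /ent mxE sum_enum_val. Qed.

Lemma ent_trace I (A : op R I) : \tr A = \sum_i ent A i i.
Proof. by rewrite /mxtrace sum_enum_val. Qed.

Lemma ent_adj I (A : op R I) i j : ent (adj A) i j = Num.conj (ent A j i).
Proof. by rewrite /ent !mxE. Qed.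

Lemma entZ I a (A : op R I) i j : ent (a *: A) i j = a * ent A i j.
Proof. by rewrite /ent mxE. Qed.

Lemma entD I (A B : op R I) i j : ent (A + B) i j = ent A i j + ent B i j.
Proof. by rewrite /ent mxE. Qed.

Lemma ent1 I i j : ent (1%:M : op R I) i j = (i == j)%:R.
Proof. by rewrite /ent mxE (inj_eq enum_rank_inj). Qed.

Lemma ent0 I i j : ent (0 : op R I) i j = 0.
Proof. by rewrite /ent mxE. Qed.

Lemma ent_sum I J (P : pred J) (A : J -> op R I) i j :
  ent (\sum_(k | P k) A k) i j = \sum_(k | P k) ent (A k) i j.
Proof. by rewrite /ent summxE. Qed.

Lemma psd_ent I (A : op R I) :
  psd A <-> adj A = A /\
    forall v : I -> C, 0 <= \sum_i \sum_j v i * ent A i j * Num.conj (v j).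
Proof.
have key (v : 'rV[C]_#|I|) : (v *m A *m map_mx Num.conj (v ^T)) 0 0 =
   \sum_i \sum_j v 0 (enum_rank i) * ent A i j * Num.conj (v 0 (enum_rank j)).
  rewrite mxE sum_enum_val exchange_big /=; apply: eq_bigr => j _.
  by rewrite !mxE sum_enum_val mulr_suml.
split=> -[hA pA]; split=> // v; last by rewrite key.
have := pA (\row_a v (enum_val a)); rewrite key.
by under eq_bigr do under eq_bigr do rewrite !mxE !enum_rankK.
Qed.

Lemma adjM I (A B : op R I) : adj (A *m B) = adj B *m adj A.
Proof. by rewrite /adj trmx_mul map_mxM. Qed.

Lemma adjK I (A : op R I) : adj (adj A) = A.
Proof. by apply: entP => i j; rewrite !ent_adj conjCK. Qed.

Lemma adjD I (A B : op R I) : adj (A + B) = adj A + adj B.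
Proof. by apply: entP => i j; rewrite !(ent_adj, entD) rmorphD. Qed.

Lemma conjr (x : R) : Num.conj (real_complex R x) = real_complex R x.
Proof. by apply/CrealP/complex_realP; exists x. Qed.

Lemma adjZr I (x : R) (A : op R I) :
  adj (real_complex R x *: A) = real_complex R x *: adj A.
Proof. by apply: entP => i j; rewrite !(ent_adj, entZ) rmorphM /= conjr. Qed.

Lemma psd_congr I (S A : op R I) : psd A -> psd (adj S *m A *m S).
Proof.
move=> [hA pA]; split; first by rewrite !adjM adjK hA mulmxA.
move=> v; have := pA (v *m adj S); congr (_ <= fun_of_matrix _ 0 0).
by rewrite trmx_mul map_mxM -/(adj (adj S)) !mulmxA; congr (_ *m _ *m _); rewrite -[RHS]adjK.
Qed.

Lemma psdZ I (x : R) (A : op R I) : 0 <= x -> psd A -> psd (real_complex R x *: A).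
Proof.
move=> x0 [hA pA]; split; first by rewrite adjZr hA.
by move=> v; rewrite -scalemxAr -scalemxAl mxE mulr_ge0 // ler0c.
Qed.

Lemma psd_sum I J (A : J -> op R I) : (forall k, psd (A k)) -> psd (\sum_k A k).
Proof.
move=> pA; elim/big_rec: _ => [|k B _ [hB pB]].
  split=> [|v]; last by rewrite mulmx0 mul0mx mxE.
  by apply: entP => i j; rewrite ent_adj !ent0 conjC0.
have [hk pk] := pA k; split=> [|v]; first by rewrite adjD hk hB.
by rewrite mulmxDr mulmxDl mxE addr_ge0.
Qed.

(** The new matrix is block diagonal along the fibres of [c]. Pushing the part of [v] on the fibre
    over [k] forward along [p] gives a vector [w k], and the quadratic form at [v] is the sum over
    [k] of the form of [A] at [w k]. *)
Lemma psd_pullback I J K (c : J -> K) (p : J -> I) (A : op R I) :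
  psd A -> psd (mkop (fun s t => (c s == c t)%:R * ent A (p s) (p t))).
Proof.
move=> /psd_ent[hA pA]; apply/psd_ent; split=> [|v].
  apply: entP => i j; rewrite ent_adj !ent_mkop rmorphM /= conjC_nat eq_sym.
  by rewrite -{2}hA ent_adj.
pose w k i := \sum_(s | (c s == k) && (p s == i)) v s.
suff -> : \sum_s \sum_t v s * ent (mkop (fun s t => (c s == c t)%:R * ent A (p s) (p t))) s t
     * Num.conj (v t) = \sum_k \sum_i \sum_j w k i * ent A i j * Num.conj (w k j).
  by apply: sumr_ge0 => k _; apply: pA.
transitivity (\sum_k \sum_(s | c s == k) \sum_(t | c t == k)
    v s * ent A (p s) (p t) * Num.conj (v t)).
  rewrite (partition_big c xpredT) //=; apply: eq_bigr => k _.
  apply: eq_bigr => s /eqP sk; rewrite [RHS]big_mkcond /=; apply: eq_bigr => t _.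
  by rewrite ent_mkop sk [k == _]eq_sym; case: eqP => _; rewrite ?mul1r // mul0r mulr0 mul0r.
apply: eq_bigr => k _; rewrite (partition_big p xpredT) //=; apply: eq_bigr => i _.
under eq_bigr => s _ do rewrite (partition_big p xpredT) //=.
rewrite exchange_big; apply: eq_bigr => j _ /=.
rewrite /w rmorph_sum !mulr_suml; apply: eq_bigr => s /andP[_ /eqP <-].
rewrite mulr_sumr; by apply: eq_bigr => t /andP[_ /eqP <-].
Qed.

End Entries.

(** * Functional calculus of Hermitian operators *)

Section FunctionalCalculus.
Variable R : realType.
Local Notation C := R[i].
Local Notation toC := (real_complex R).
Implicit Types I J K : finType.

Lemma Re_real_complex (x : R) : complex.Re (toC x) = x.
Proof. by []. Qed.

Definition reigen I (A : op R I) : 'rV[R]_#|I| :=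
  map_mx (@complex.Re R) (spectral_diag A).

(** [Q] stands for the inverse of [P]. Keeping both as arguments lets a multiplicative map such as
    [embed] act on each factor without computing an inverse. *)
Definition conjdiag I (P Q : op R I) (d : 'rV[R]_#|I|) : op R I :=
  P *m diag_mx (map_mx toC d) *m Q.

Lemma conjdiagM I (P Q : op R I) d e : Q *m P = 1%:M ->
  conjdiag P Q d *m conjdiag P Q e = conjdiag P Q (\row_i (d 0 i * e 0 i)).
Proof.
move=> QP; rewrite /conjdiag !mulmxA -[_ *m Q *m P]mulmxA QP mulmx1.
rewrite -[P *m _ *m _]mulmxA mulmx_diag; congr (_ *m diag_mx _ *m _).
by apply/rowP => i; rewrite !mxE rmorphM.
Qed.

Lemma conjdiagB I (P Q : op R I) d e :
  conjdiag P Q d - conjdiag P Q e = conjdiag P Q (d - e).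
Proof.
by rewrite /conjdiag -mulmxBl -mulmxBr -linearB /= map_mxB.
Qed.

Lemma trace_conjdiag I (P Q : op R I) d : Q *m P = 1%:M ->
  \tr (conjdiag P Q d) = toC (\sum_i d 0 i).
Proof.
move=> QP; rewrite mxtrace_mulC mulmxA QP mul1mx mxtrace_diag rmorph_sum.
by apply: eq_bigr => i _; rewrite mxE.
Qed.

Lemma adj_hermsymmx I (A : op R I) : adj A = A -> A \is hermsymmx.
Proof.
move=> hA; apply/is_hermitianmxP; rewrite expr0 scale1r -{1}hA.
by rewrite /adj.
Qed.

Lemma spectralmxK I (A : op R I) : spectralmx A *m invmx (spectralmx A) = 1%:M.
Proof. by rewrite mulmxV // spectral_unit. Qed.

Lemma adj_spectralmx I (A : op R I) : adj (spectralmx A) = invmx (spectralmx A).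
Proof. by rewrite invmx_unitary // spectral_unitarymx. Qed.

Lemma funmxE I f (A : op R I) : funmx f A =
  conjdiag (invmx (spectralmx A)) (spectralmx A) (map_mx f (reigen A)).
Proof.
rewrite /funmx /conjdiag; congr (_ *m diag_mx _ *m _).
by apply/rowP => i; rewrite !mxE.
Qed.

Lemma funmx_id I (A : op R I) : adj A = A -> funmx id A = A.
Proof.
move=> hA; have hs := adj_hermsymmx hA.
rewrite [RHS](orthomx_spectralP (hermitian_normalmx hs)) /funmx.
congr (_ *m diag_mx _ *m _); apply/rowP => i; rewrite mxE.
by apply: RRe_real; apply: (mxOverP (hermitian_spectral_diag_real hs)).
Qed.

Lemma spectralE I (A : op R I) : adj A = A ->
  A = conjdiag (invmx (spectralmx A)) (spectralmx A) (reigen A).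
Proof. by move=> hA; rewrite -{1}(funmx_id hA) funmxE map_mx_id. Qed.

(* Functional calculus does not depend on the diagonalization: an intertwiner T
   of two diagonal matrices has T_ij (b_i - a_j) = 0, hence T_ij (f b_i - f a_j) = 0. *)
Lemma funmx_conjdiag I f (P Q : op R I) d : Q *m P = 1%:M ->
  adj (conjdiag P Q d) = conjdiag P Q d ->
  funmx f (conjdiag P Q d) = conjdiag P Q (map_mx f d).
Proof.
move=> QP hA; set A := conjdiag P Q d.
have eA : A = conjdiag P Q d by [].
clearbody A.
rewrite -eA in hA; have := spectralE hA; rewrite funmxE.
set X := spectralmx A; set e := reigen A; move=> eA'.
have XX : X *m invmx X = 1%:M by rewrite spectralmxK.
have XX' : invmx X *m X = 1%:M by rewrite mulVmx // spectral_unit.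
clearbody X e.
have PQ : P *m Q = 1%:M by apply: mulmx1C.
pose T := X *m P.
have TE : T *m diag_mx (map_mx toC d) = diag_mx (map_mx toC e) *m T.
  transitivity (X *m A *m P); first by rewrite eA /conjdiag -!mulmxA QP mulmx1.
  by rewrite eA' /conjdiag /T !mulmxA XX mul1mx.
have TF : T *m diag_mx (map_mx toC (map_mx f d)) =
    diag_mx (map_mx toC (map_mx f e)) *m T.
  apply/matrixP => i j; move/matrixP/(_ i j): TE.
  rewrite !mul_mx_diag !mul_diag_mx ![in RHS]mxE ![in LHS]mxE.
  rewrite !mxE [toC (d 0 j)]lock [toC (e 0 i)]lock => /eqP.
  rewrite mulrC -subr_eq0 -mulrBl mulf_eq0 => /orP[|/eqP ->]; last by rewrite mulr0 mul0r.
  rewrite subr_eq0 -!lock => /eqP/complexI ->; exact: mulrC.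
rewrite /conjdiag; have -> : X = T *m Q by rewrite /T -mulmxA PQ mulmx1.
rewrite mulmxA -[_ *m _ *m T]mulmxA -TF /T !mulmxA.
have -> : invmx (X *m P *m Q) = invmx X by rewrite -mulmxA PQ mulmx1.
by rewrite XX' mul1mx.
Qed.

Lemma funmx_herm I f (A : op R I) : adj (funmx f A) = funmx f A.
Proof.
rewrite funmxE /conjdiag -adj_spectralmx !adjM adjK mulmxA; congr (_ *m _ *m _).
rewrite /adj tr_diag_mx map_diag_mx; congr diag_mx.
by apply/rowP => i; rewrite !mxE; exact: conjr.
Qed.

Lemma trace_funmx I f (A : op R I) :
  \tr (funmx f A) = toC (\sum_i f (reigen A 0 i)).
Proof.
rewrite funmxE trace_conjdiag ?spectralmxK //.
by under eq_bigr do rewrite mxE.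
Qed.

Lemma funmxM I f g (A : op R I) :
  funmx f A *m funmx g A = funmx (fun x => f x * g x) A.
Proof.
rewrite !funmxE conjdiagM ?spectralmxK //; congr conjdiag.
by apply/rowP => i; rewrite !mxE.
Qed.

Lemma funmxB I f g (A : op R I) :
  funmx f A - funmx g A = funmx (fun x => f x - g x) A.
Proof.
rewrite !funmxE conjdiagB; congr conjdiag.
by apply/rowP => i; rewrite !mxE.
Qed.

Lemma eq_funmx I f g (A : op R I) : (forall i, f (reigen A 0 i) = g (reigen A 0 i)) ->
  funmx f A = funmx g A.
Proof.
by move=> fg; rewrite !funmxE; congr conjdiag; apply/rowP => i; have := fg i; rewrite !mxE.
Qed.

Lemma conjdiagZ I (P Q : op R I) c d :
  toC c *: conjdiag P Q d = conjdiag P Q (c *: d).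
Proof.
rewrite /conjdiag scalemxAl scalemxAr -linearZ /=; congr (_ *m diag_mx _ *m _).
by apply/rowP => i; rewrite !mxE rmorphM.
Qed.

Lemma funmxZl I f c (A : op R I) : toC c *: funmx f A = funmx (fun x => c * f x) A.
Proof.
rewrite !funmxE conjdiagZ; congr conjdiag.
by apply/rowP => i; rewrite !mxE.
Qed.

Lemma funmxZ I f c (A : op R I) : adj A = A ->
  funmx f (toC c *: A) = funmx (fun x => f (c * x)) A.
Proof.
move=> hA; rewrite [RHS]funmxE {1}(spectralE hA) conjdiagZ funmx_conjdiag ?spectralmxK //.
  by congr conjdiag; apply/rowP => i; rewrite !mxE.
by rewrite -conjdiagZ -spectralE // adjZr hA.
Qed.

(** The eigenvalue is the quadratic form of [A] at row [i] of [spectralmx A], a unit eigenvector. *)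
Lemma psd_reigen_ge0 I (A : op R I) i : psd A -> 0 <= reigen A 0 i.
Proof.
move=> [hA pA]; have := pA (row i (spectralmx A)).
set X := spectralmx A.
have -> : (row i X *m A *m map_mx Num.conj ((row i X)^T)) 0 0 = (X *m A *m adj X) i i.
  rewrite -row_mul [LHS]mxE [RHS]mxE; apply: eq_bigr => k _.
  by congr (_ * _); [rewrite [LHS]mxE | rewrite !mxE].
rewrite adj_spectralmx -/X {1}(spectralE hA) /conjdiag -/X.
have -> : X *m (invmx X *m diag_mx (map_mx toC (reigen A)) *m X) *m invmx X =
   diag_mx (map_mx toC (reigen A)).
  by rewrite !mulmxA spectralmxK mul1mx -mulmxA spectralmxK mulmx1.
by rewrite !mxE eqxx mulr1n ler0c.
Qed.

End FunctionalCalculus.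

(** * Tangent-line inequalities for powers and for [x ln x] *)

Section ScalarConvexity.
Variable R : realType.
Implicit Types (f : R -> R) (a x m : R).

(* The tangent is only required at m > 0: x ln x and - x^a have none at 0. *)
Definition tangent_below f :=
  f 0 = 0 /\ forall m, 0 < m -> exists c, forall x, 0 <= x -> f m + c * (x - m) <= f x.

Lemma ln_le_subr1 x : 0 < x -> ln x <= x - 1.
Proof.
move=> x0; have := @le_ln1Dx R (x - 1); rewrite [1 + _]addrC subrK; apply.
by rewrite ltrBrDl subrr.
Qed.

(** Bernoulli's inequality. The bound [ln y <= y - 1] is taken at [y = x / x^a] with weight [a] and
    at [y = x^-a] with weight [1 - a]; the logarithms cancel in the sum. *)
Lemma powR_le_tangent1 a x : 0 < a < 1 -> 0 <= x -> powR x a <= a * x + (1 - a).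
Proof.
move=> /andP[a0 a1]; rewrite le_eqVlt => /predU1P[<-|x0].
  by rewrite powR0 ?gt_eqF// mulr0 add0r subr_ge0 ltW.
have m0 := powR_gt0 a x0.
have h1 := ln_le_subr1 (divr_gt0 x0 m0).
rewrite ln_div // ln_powR in h1.
have := @ln_le_subr1 (powR x a)^-1; rewrite invr_gt0 lnV // ln_powR => /(_ m0) h2.
have : 1 <= (a * x + (1 - a)) / powR x a by rewrite mulrDl; nra.
by rewrite ler_pdivlMr // mul1r.
Qed.

(** The concave case for the exponent [a^-1], evaluated at [x^a]. *)
Lemma powR_ge_tangent1 a x : 1 < a -> 0 <= x -> a * (x - 1) + 1 <= powR x a.
Proof.
move=> a1 x0; have a0 : 0 < a by apply: lt_trans a1.
have := @powR_le_tangent1 a^-1 (powR x a); rewrite invr_gt0 a0 invf_lt1 // a1.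
move=> /(_ isT (powR_ge0 _ _)); rewrite -powRrM divff ?gt_eqF // powRr1 //.
have -> : a^-1 * powR x a + (1 - a^-1) = (powR x a + a - 1) / a.
  by field; rewrite gt_eqF.
by rewrite ler_pdivlMr //; lra.
Qed.

Lemma pw_ge0 a x : 0 <= pw a x.
Proof. by rewrite /pw; case: ifP => // _; exact: powR_ge0. Qed.

Lemma pwM a c x : 0 < c -> pw a (c * x) = powR c a * pw a x.
Proof.
move=> c0; rewrite /pw pmulr_rgt0 //; case: ifP => x0; last by rewrite mulr0.
by rewrite powRM // ltW.
Qed.

Lemma pw_powR a x : 0 < a -> 0 <= x -> pw a x = powR x a.
Proof.
by rewrite /pw => a0; rewrite le_eqVlt => /predU1P[<-|->//]; rewrite ltxx powR0 ?gt_eqF.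
Qed.

Lemma tangent_below_pw a : 1 < a -> tangent_below (pw a).
Proof.
move=> a1; have a0 : 0 < a by apply: lt_trans a1.
split; first by rewrite /pw ltxx.
(* The slope is the derivative [a m^(a-1)]. Factoring out [m^a] reduces the claim to the tangent at
   [1], evaluated at [x / m]. *)
move=> m m0; exists (a * powR m a / m) => x x0.
have -> : pw a x = powR m a * powR (x / m) a.
  by rewrite -powRM ?divr_ge0 ?(ltW m0) // mulrC divfK ?gt_eqF // pw_powR.
rewrite pw_powR ?(ltW m0) //.
have -> : powR m a + a * powR m a / m * (x - m) = powR m a * (a * (x / m - 1) + 1).
  by field; rewrite gt_eqF.
by rewrite ler_wpM2l ?powR_ge0 // powR_ge_tangent1 // divr_ge0 // ltW.
Qed.

Lemma tangent_below_oppr_pw a : 0 < a < 1 -> tangent_below (fun x => - pw a x).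
Proof.
move=> ha; have /andP[a0 a1] := ha.
split; first by rewrite /pw ltxx oppr0.
move=> m m0; exists (- (a * powR m a / m)) => x x0.
have -> : pw a x = powR m a * powR (x / m) a.
  by rewrite -powRM ?divr_ge0 ?(ltW m0) // mulrC divfK ?gt_eqF // pw_powR.
rewrite pw_powR ?(ltW m0) //.
have -> : - powR m a + - (a * powR m a / m) * (x - m) =
    - (powR m a * (a * (x / m) + (1 - a))).
  by field; rewrite gt_eqF.
by rewrite lerN2 ler_wpM2l ?powR_ge0 // powR_le_tangent1 // divr_ge0 // ltW.
Qed.

(** With slope [ln m + 1] the claim becomes [x ln (m / x) <= m - x]. *)
Lemma tangent_below_xlnx : tangent_below (fun x => x * lnp x).
Proof.
split=> [|m m0]; first by rewrite mul0r.
exists (ln m + 1) => x; rewrite {1}/lnp m0 le_eqVlt => /predU1P[<-|x0].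
  by rewrite mul0r; nra.
rewrite /lnp x0; have : ln (m / x) <= m / x - 1.
  by rewrite ln_le_subr1 // divr_gt0.
rewrite ln_div // -(ler_pM2l x0) mulrBr mulrBr [x * (m / x)]mulrC divfK ?gt_eqF //.
by move: (ln x) (ln m) => u v; lra.
Qed.

End ScalarConvexity.

(** * Jensen's trace inequality for positive trace-preserving maps *)

Section Jensen.
Variable R : realType.
Local Notation C := R[i].
Local Notation toC := (real_complex R).
Implicit Types I J K : finType.

Definition op_linear I J (F : op R I -> op R J) :=
  forall a A B, F (a *: A + B) = a *: F A + F B.

Lemma op_linear0 I J (F : op R I -> op R J) : op_linear F -> F 0 = 0.
Proof.
move=> lF; have := lF 1 0 0; rewrite !scale1r addr0 => /esym/eqP.
by rewrite -subr_eq0 addrK => /eqP.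
Qed.

Lemma op_linear_sum I J K (F : op R I -> op R J) (lF : op_linear F)
  (P : pred K) (a : K -> C) A : F (\sum_(k | P k) a k *: A k) = \sum_(k | P k) a k *: F (A k).
Proof.
elim/big_rec2: _ => [|k X Y _ <-]; first exact: op_linear0.
by rewrite lF.
Qed.

Lemma op_linearZ I J (F : op R I -> op R J) (lF : op_linear F) a A : F (a *: A) = a *: F A.
Proof. by rewrite -[_ *: A]addr0 lF op_linear0 // addr0. Qed.

Lemma op_linearB I J (F : op R I -> op R J) (lF : op_linear F) A B : F (A - B) = F A - F B.
Proof. by rewrite -[A - B]addrC -scaleN1r lF scaleN1r addrC. Qed.

Lemma psd_delta I (i : 'I_#|I|) : psd (delta_mx i i : op R I).
Proof.
split=> [|v].
  by apply/matrixP => a b; rewrite !mxE conjC_nat andbC.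
have -> : (delta_mx i i : op R I) = delta_mx i (0 : 'I_1) *m delta_mx 0 i.
  by rewrite mul_delta_mx.
rewrite mulmxA -colE -mulmxA -rowE mxE big_ord1 !mxE.
exact: mul_conjC_ge0.
Qed.

(** Each [mu i] is the mean of the numbers [D * la j] under the probability weights [p i j / D], so
    Jensen applies row by row; the column sums then collapse the double sum. *)
Lemma sum_jensen (m n : nat) (f : R -> R) (D : R) (p : 'I_m -> 'I_n -> R)
    (mu : 'I_m -> R) (la : 'I_n -> R) :
  tangent_below f -> 0 < D ->
  (forall i j, 0 <= p i j) -> (forall j, 0 <= la j) ->
  (forall i, mu i = \sum_j la j * p i j) ->
  (forall i, \sum_j p i j = D) -> (forall j, \sum_i p i j = 1) ->
  \sum_i f (mu i) <= D^-1 * \sum_j f (D * la j).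
Proof.
move=> [f0 ft] D0 p0 l0 muE rowp colp.
have step i : f (mu i) <= D^-1 * \sum_j p i j * f (D * la j).
  have : 0 <= mu i by rewrite muE sumr_ge0 // => j _; rewrite mulr_ge0.
  (* No tangent is available at [mu i = 0]. There every product [la j * p i j] vanishes, and
     [f 0 = 0] makes both sides zero. *)
  rewrite le_eqVlt => /predU1P[mi0|mi0].
    rewrite -mi0 f0 big1 ?mulr0 // => j _.
    have h0 : forall k, xpredT k -> 0 <= la k * p i k by move=> k _; exact: mulr_ge0.
    have := psumr_eq0P h0 (etrans (esym (muE i)) (esym mi0)); move=> /(_ j isT)/eqP.
    by rewrite mulf_eq0 => /orP[] /eqP ->; rewrite ?(mulr0, mul0r, f0).
  have [c hc] := ft _ mi0; rewrite mulrC ler_pdivlMr //.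
  (* The linear term of the tangent averages to zero, since both [D * la j] and the constant [mu i]
     have [p i]-weighted sum [D * mu i]. *)
  have -> : f (mu i) * D = \sum_j p i j * (f (mu i) + c * (D * la j - mu i)).
    transitivity (\sum_j ((f (mu i) - c * mu i) * p i j + (c * D) * (la j * p i j))).
      by rewrite big_split /= -!mulr_sumr -muE rowp; ring.
    by apply: eq_bigr => j _; ring.
  by apply: ler_sum => j _; rewrite ler_wpM2l // hc // mulr_ge0 // ltW.
apply: (le_trans (ler_sum _ (fun i _ => step i))).
rewrite -mulr_sumr exchange_big /= ler_pM2l ?invr_gt0 // le_eqVlt; apply/orP; left.
by apply/eqP/eq_bigr => j _; rewrite -mulr_suml colp mul1r.
Qed.

(* The diagonal of F(Y) in an eigenbasis of F(Y) is the image of the spectrum of Y under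
   the matrix p i j = <u_i, F(|v_j><v_j|) u_i>, whose rows sum to D since F(1) = D
   and whose columns sum to 1 since F preserves the trace. *)
Lemma trace_jensen I J (F : op R I -> op R J) (D : R) f (Y : op R I) :
  op_linear F -> (forall A, psd A -> psd (F A)) -> (forall A, \tr (F A) = \tr A) ->
  F 1%:M = toC D *: 1%:M -> 0 < D -> tangent_below f -> psd Y ->
  \sum_i f (reigen (F Y) 0 i) <= D^-1 * \sum_j f (D * reigen Y 0 j).
Proof.
move=> lF pF tF F1 D0 tf pY; have pFY := pF _ pY.
have YE := spectralE pY.1; have FYE := spectralE pFY.1.
have l0 j := psd_reigen_ge0 j pY.
move: l0; set la := reigen Y in YE *; set mu := reigen (F Y) in FYE * => l0.
set X := spectralmx Y in YE; set Q := spectralmx (F Y) in FYE.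
have XX : invmx X *m X = 1%:M by rewrite mulVmx // spectral_unit.
have QQ : Q *m invmx Q = 1%:M by rewrite spectralmxK.
have QQ' : invmx Q *m Q = 1%:M by rewrite mulVmx // spectral_unit.
have aQ : invmx Q = adj Q by rewrite adj_spectralmx.
have aX : invmx X = adj X by rewrite adj_spectralmx.
pose E j : op R I := invmx X *m delta_mx j j *m X.
have pE j : psd (E j) by rewrite /E aX; apply/psd_congr/psd_delta.
have sumE (d : 'rV_#|I|) : invmx X *m diag_mx d *m X = \sum_j d 0 j *: E j.
  rewrite diag_mx_sum_delta mulmx_sumr mulmx_suml; apply: eq_bigr => j _.
  by rewrite -scalemxAr -scalemxAl.
pose q i j : C := (Q *m F (E j) *m invmx Q) i i.
have q0 i j : 0 <= q i j.
  have [_ /(_ (row i Q))] := pF _ (pE j); rewrite /q aQ.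
  rewrite -row_mul !mxE; congr (_ <= _); apply: eq_bigr => k _.
  by congr (_ * _); [rewrite [LHS]mxE | rewrite !mxE].
have qE i j : q i j = toC (complex.Re (q i j)).
  by rewrite RRe_real // ger0_real.
clearbody X Q la mu.
apply: (@sum_jensen _ _ f D (fun i j => complex.Re (q i j))) => //.
- by move=> i j; rewrite -ler0c -qE.
- move=> i; apply: (@complexI R); rewrite rmorph_sum /=.
  under eq_bigr => j _ do rewrite rmorphM /= -qE.
  transitivity ((Q *m F Y *m invmx Q) i i).
    by rewrite FYE /conjdiag !mulmxA QQ mul1mx -mulmxA QQ mulmx1 !mxE eqxx mulr1n.
  rewrite {1}YE /conjdiag sumE (op_linear_sum lF) mulmx_sumr mulmx_suml summxE.
  apply: eq_bigr => j _; rewrite -scalemxAr -scalemxAl [LHS]mxE; congr (_ * _).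
  by rewrite mxE.
- move=> i; apply: (@complexI R); rewrite rmorph_sum /=.
  under eq_bigr => j _ do rewrite -qE.
  transitivity ((Q *m F 1%:M *m invmx Q) i i).
    have -> : (1%:M : op R I) = invmx X *m diag_mx (const_mx 1) *m X.
      by rewrite diag_const_mx mulmx1 XX.
    rewrite sumE (op_linear_sum lF).
    rewrite mulmx_sumr mulmx_suml summxE.
    by apply: eq_bigr => j _; rewrite [const_mx _ _ _]mxE scale1r.
  by rewrite F1 -scalemxAr -scalemxAl mulmx1 QQ !mxE eqxx mulr1.
- move=> j; apply: (@complexI R); rewrite rmorph_sum /=.
  under eq_bigr => i _ do rewrite -qE.
  rewrite -/(mxtrace (Q *m F (E j) *m invmx Q)) mxtrace_mulC mulmxA QQ' mul1mx tF.
  rewrite /E mxtrace_mulC mulmxA (mulmx1C XX) mul1mx.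
  rewrite /mxtrace (bigD1 j) //= mxE !eqxx big1 ?addr0 // => k /negPf kj.
  by rewrite mxE kj.
Qed.

End Jensen.

(** * Operators acting on one tensor factor only *)

Section Embedding.
Variable R : realType.
Local Notation C := R[i].
Local Notation toC := (real_complex R).
Variables (T W K : finType) (h : T -> W * K).
Hypothesis bh : bijective h.
Implicit Types X Y : op R K.

(* 1_W (x) X, transported along h. *)
Definition embed X : op R T :=
  mkop (fun s t => ((h s).1 == (h t).1)%:R * ent X (h s).2 (h t).2).

Lemma ent_embed X s t :
  ent (embed X) s t = ((h s).1 == (h t).1)%:R * ent X (h s).2 (h t).2.
Proof. exact: ent_mkop. Qed.

Lemma sum_bij_pair (f : W * K -> C) : \sum_t f (h t) = \sum_w \sum_k f (w, k).
Proof.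
rewrite pair_big (reindex h) /=; last exact: onW_bij.
by apply: eq_bigr => t _; rewrite -surjective_pairing.
Qed.

Lemma embedM X Y : embed (X *m Y) = embed X *m embed Y.
Proof.
apply: entP => s t; rewrite ent_mul ent_embed ent_mul.
under [RHS]eq_bigr do rewrite !ent_embed.
rewrite (sum_bij_pair (fun wk => ((h s).1 == wk.1)%:R * ent X (h s).2 wk.2 *
   ((wk.1 == (h t).1)%:R * ent Y wk.2 (h t).2))) /=.
rewrite (bigD1 (h s).1) //= [X in _ + X]big1 ?addr0 => [|w ne].
  by rewrite mulr_sumr; apply: eq_bigr => k _; rewrite eqxx mul1r mulrCA.
by rewrite big1 // => k _; rewrite [_ == w]eq_sym (negPf ne) !mul0r.
Qed.

Lemma embed1 : embed 1%:M = 1%:M.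
Proof.
apply: entP => s t; rewrite ent_embed !ent1 -natrM mulnb.
by rewrite -(bij_eq bh) [h s]surjective_pairing [h t]surjective_pairing.
Qed.

Lemma embedZ a X : embed (a *: X) = a *: embed X.
Proof. by apply: entP => s t; rewrite !(ent_embed, entZ) mulrCA. Qed.

Lemma embedD X Y : embed (X + Y) = embed X + embed Y.
Proof. by apply: entP => s t; rewrite !(ent_embed, entD) mulrDr. Qed.

Lemma embedB X Y : embed (X - Y) = embed X - embed Y.
Proof. by rewrite -scaleN1r embedD embedZ scaleN1r. Qed.

Lemma adj_embed X : adj (embed X) = embed (adj X).
Proof.
by apply: entP => s t; rewrite !(ent_embed, ent_adj) rmorphM /= conjC_nat eq_sym.
Qed.

Lemma embed_conjdiag (P Q : op R K) d : embed (conjdiag P Q d) =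
  conjdiag (embed P) (embed Q) (\row_a d 0 (enum_rank (h (enum_val a)).2)).
Proof.
rewrite /conjdiag !embedM; congr (_ *m _ *m _).
apply: entP => s t; rewrite ent_embed /ent !mxE (inj_eq enum_rank_inj) enum_rankK.
rewrite (inj_eq enum_rank_inj) -(bij_eq bh) [h s]surjective_pairing [h t]surjective_pairing.
rewrite xpair_eqE /=; case: eqP => _ /=; case: eqP => _ /=.
all: by rewrite ?mulr1n ?mulr0n ?mul1r ?mul0r.
Qed.

(** Embedding a diagonalization of [X] diagonalizes [embed X]. It need not be the one chosen by
    [spectralmx], but [funmx_conjdiag] allows any. *)
Lemma funmx_embed f X : adj X = X -> funmx f (embed X) = embed (funmx f X).
Proof.
move=> hX; have hE : adj (embed X) = embed X by rewrite adj_embed hX.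
have XE := spectralE hX.
have EE := congr1 embed XE; rewrite embed_conjdiag in EE.
rewrite EE funmx_conjdiag -?EE //; last by rewrite -embedM spectralmxK embed1.
by rewrite funmxE embed_conjdiag; congr conjdiag; apply/rowP => i; rewrite !mxE.
Qed.

End Embedding.

(** * Data processing for the sandwiched Rényi relative entropies *)

Lemma Re_traceB (R : realType) (I : finType) (A B1 B2 : op R I) :
  complex.Re (\tr (A *m (B1 - B2))) = complex.Re (\tr (A *m B1)) - complex.Re (\tr (A *m B2)).
Proof. by rewrite mulmxBr raddfB /=; case: (\tr _) => ? ?; case: (\tr _). Qed.

Lemma umegakiE (R : realType) (I : finType) (A B : op R I) : psd A ->
  complex.Re (\tr (A *m (funmx (@lnp R) A - B))) =
  \sum_i reigen A 0 i * lnp (reigen A 0 i) - complex.Re (\tr (A *m B)).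
Proof.
move=> pA; rewrite Re_traceB -{1}(funmx_id pA.1) funmxM trace_funmx.
by rewrite Re_real_complex.
Qed.

Section DataProcessing.
Variable R : realType.
Local Notation C := R[i].
Local Notation toC := (real_complex R).
Variables (T T' W W' K : finType) (h : T -> W * K) (h' : T' -> W' * K).
Hypotheses (bh : bijective h) (bh' : bijective h').
Variables (F : op R T -> op R T') (D : R) (x : op R K) (tau : op R T).
Hypotheses (D0 : 0 < D) (px : psd x) (ptau : psd tau) (ttau : \tr tau = 1).
Hypotheses (lF : op_linear F) (pF : forall A, psd A -> psd (F A)).
Hypotheses (tF : forall A, \tr (F A) = \tr A) (F1 : F 1%:M = toC D *: 1%:M).
Hypothesis Fmod : forall s t A,
  F (embed h s *m A *m embed h t) = embed h' s *m F A *m embed h' t.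

Local Notation sigma := (embed h (toC D^-1 *: x)).
Local Notation sigma' := (embed h' x).

Let FmodL s A : F (embed h s *m A) = embed h' s *m F A.
Proof. by have := Fmod s 1%:M A; rewrite !embed1 // !mulmx1. Qed.

Let FmodR s A : F (A *m embed h s) = F A *m embed h' s.
Proof. by have := Fmod 1%:M s A; rewrite !embed1 // !mul1mx. Qed.

Let sigma_herm : adj (toC D^-1 *: x) = toC D^-1 *: x.
Proof. by rewrite adjZr px.1. Qed.

(** The module property reduces this to [F 1], whose factor [D] cancels the [D^-1] in [sigma]. *)
Lemma F_sigma : F sigma = sigma'.
Proof.
rewrite -[embed h _]mulmx1 FmodL F1 -scalemxAr mulmx1 embedZ scalerA.
by rewrite -rmorphM divff ?gt_eqF // scale1r.
Qed.

(** The orthogonal projection onto the support of [x]. *)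
Let supp := funmx (fun t : R => (0 < t)%R%:R) x.

Let supp_x : supp *m x = x.
Proof.
suff : supp *m funmx id x = funmx id x by rewrite funmx_id ?px.1.
rewrite /supp funmxM; apply: eq_funmx => i /=.
have := psd_reigen_ge0 i px; rewrite le_eqVlt => /predU1P[<-|->].
  by rewrite mulr0.
by rewrite mul1r.
Qed.

Let x_pinv : x *m funmx (fun t => if 0 < t then t^-1 else 0) x = supp.
Proof.
rewrite -{1}(funmx_id px.1) /supp funmxM; apply: eq_funmx => i /=.
by case: ifP => [h0|_]; rewrite ?mulr0 // divff // gt_eqF.
Qed.

(** Since [supp *m x = x], every row of [1 - embed h supp] is annihilated by [sigma], hence by
    [tau]. *)
Let supp_tau : supp_le tau sigma -> embed h supp *m tau = tau.
Proof.
move=> hs; apply/eqP; rewrite eq_sym -subr_eq0 -{1}[tau]mul1mx -mulmxBl -(embed1 _ bh).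
rewrite -embedB; apply/eqP/row_matrixP => i; rewrite row_mul row0; apply: hs.
rewrite -row_mul embedZ -scalemxAr -embedM // mulmxBl mul1mx supp_x subrr.
have -> : embed h (0 : op R K) = 0 by rewrite -(scale0r 0) embedZ scale0r.
by rewrite scaler0 row0.
Qed.

(** [F tau] absorbs [embed h' supp] on its left, and [supp] is [x] times its generalized inverse; so
    a row killed by [sigma'] is killed by [F tau]. *)
Lemma supp_le_processing : supp_le tau sigma -> supp_le (F tau) sigma'.
Proof.
move=> /supp_tau hs v vs; rewrite -hs FmodL -x_pinv embedM //.
by rewrite !mulmxA vs !mul0mx.
Qed.

(** Every [l] admissible for [tau] stays admissible for [F tau], by positivity of [F] and
    [F_sigma]. *)
Lemma max_D_processing :
  (sandwichedD +oo (F tau) sigma' <= sandwichedD +oo tau sigma)%E.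
Proof.
apply: ereal_inf_le_tmp => _ [l [l0 pl] <-]; exists l => //; split=> //.
by have := pF pl; rewrite (op_linearB lF) (op_linearZ lF) F_sigma.
Qed.

(** Replacing [ln sigma] by [ln sigma'] in the cross term and applying Jensen to [x ln x] each
    produce one [ln D]; the two cancel. *)
Lemma umegaki_D_processing :
  (sandwichedD 1%:E (F tau) sigma' <= sandwichedD 1%:E tau sigma)%E.
Proof.
rewrite /sandwichedD eqxx; case: asboolP => [hs'|ns']; last first.
  by case: asboolP => // /supp_le_processing.
case: asboolP => [hs|_]; last by rewrite leey.
rewrite lee_fin [X in X <= _](umegakiE _ (pF ptau)) [X in _ <= X](umegakiE _ ptau).
rewrite (funmx_embed bh' _ px.1) (funmx_embed bh _ sigma_herm) (funmxZ _ _ px.1).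
set L := funmx (@lnp R) x.
(* [lnp] vanishes off the support, so the shift by [- ln D] multiplies [supp] instead of the
   identity. *)
have -> : funmx (fun t => lnp (D^-1 * t)) x = L - toC (ln D) *: supp.
  rewrite /supp funmxZl funmxB; apply: eq_funmx => i.
  rewrite /lnp pmulr_rgt0 ?invr_gt0 //; case: ifP => t0; last by rewrite mulr0 subr0.
  by rewrite lnM ?posrE ?invr_gt0 // lnV // mulr1 addrC.
have trs : \tr (tau *m embed h supp) = 1 by rewrite mxtrace_mulC (supp_tau hs).
have -> : complex.Re (\tr (tau *m embed h (L - toC (ln D) *: supp))) =
    complex.Re (\tr (F tau *m embed h' L)) - ln D.
  rewrite embedB Re_traceB embedZ -FmodR tF; congr (_ - _).
  by rewrite -scalemxAr mxtraceZ trs mulr1.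
set u := complex.Re _.
have := trace_jensen lF pF tF F1 D0 (@tangent_below_xlnx R) ptau.
set e := reigen tau; have tre : \sum_i e 0 i = 1.
  apply: (@complexI R); transitivity (\tr tau); last by rewrite ttau.
  by rewrite -[in RHS](funmx_id ptau.1) trace_funmx.
have -> : D^-1 * (\sum_j D * e 0 j * lnp (D * e 0 j)) =
    \sum_i e 0 i * lnp (e 0 i) + ln D.
  rewrite -[ln D]mul1r -tre mulr_suml -big_split mulr_sumr /=.
  apply: eq_bigr => i _; have := psd_reigen_ge0 i ptau; rewrite -/e le_eqVlt.
  case/predU1P => [<-|e0]; first by rewrite mulr0 !mul0r mulr0 addr0.
  rewrite /lnp pmulr_rgt0 // e0 lnM ?posrE //.
  by field; rewrite gt_eqF.
by lra.
Qed.

(** Both entropies are expressed through the single operator [Z]: the two traces are those of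
    [(F Z)^a] and [(c Z)^a], which Jensen compares. *)
Lemma renyi_D_processing (a : R) : 0 < a -> a != 1 ->
  (sandwichedD a%:E (F tau) sigma' <= sandwichedD a%:E tau sigma)%E.
Proof.
move=> a0 a1; rewrite /sandwichedD (negPf a1).
set s := (1 - a) / (2 * a).
(* It suffices to compare the two traces, in a direction fixed by the sign of [a - 1]. The value
   [+oo] assigned when [Q <= 0] requires in addition that [Q'] be positive whenever [Q] is. *)
have Q_suff (b b' : bool) (Q Q' : R) : (b' -> b) -> (0 < Q -> 0 < Q') ->
    (0 < Q -> if 1 < a then Q' <= Q else Q <= Q') ->
    ((if b' then +oo else if (Q' <= 0)%R then +oo else ((a - 1)^-1 * ln Q')%:E)
     <= (if b then +oo else if (Q <= 0)%R then +oo else ((a - 1)^-1 * ln Q)%:E))%E.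
  move=> bb Q0 QQ; case: b bb => [_|bb]; first by rewrite leey.
  have -> : b' = false by apply/negP => /bb.
  case: (lerP Q 0) => [_|q0]; first by rewrite leey.
  have q'0 := Q0 q0; rewrite [(Q' <= 0)%R]leNgt q'0 /= lee_fin.
  have := QQ q0; case: ltrP => [a_gt1|a_le1] h1.
    by rewrite ler_pM2l ?invr_gt0 ?subr_gt0 // ler_ln.
  have a_lt1 : a < 1 by rewrite lt_neqAle a1.
  by rewrite ler_nM2l ?invr_lt0 ?subr_lt0 // ler_ln.
rewrite (funmx_embed bh' _ px.1) (funmx_embed bh _ sigma_herm) (funmxZ _ _ px.1).
set H := funmx (pw s) x.
have -> : funmx (fun t => pw s (D^-1 * t)) x = toC (powR D (- s)) *: H.
  rewrite funmxZl; apply: eq_funmx => i; rewrite pwM ?invr_gt0 //.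
  by rewrite -[D^-1]powR_inv1 ?ltW // -powRrM mulN1r.
have hH : adj H = H by exact: funmx_herm.
set Z := embed h H *m tau *m embed h H.
have pZ : psd Z by rewrite /Z -{1}hH -adj_embed; apply: psd_congr.
have pFZ := pF pZ.
(* The powers of [sigma'] around [F tau] move inside [F] and give [F Z]; those of [sigma] around
   [tau] give [Z] with the scalar [D^(-s)] twice. *)
rewrite -Fmod -/Z (embedZ h _ H) -!scalemxAl -scalemxAr scalerA -rmorphM -/Z /=.
rewrite (funmxZ _ _ pZ.1) !trace_funmx !Re_real_complex.
pose c := powR D (- s) * powR D (- s); cbv beta; rewrite -/c.
have c0 : 0 < c by rewrite mulr_gt0 // powR_gt0.
set e := reigen Z; set e' := reigen (F Z).
have tre : \sum_i e' 0 i = \sum_i e 0 i.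
  have : \tr (funmx id (F Z)) = \tr (funmx id Z).
    by rewrite (funmx_id pFZ.1) (funmx_id pZ.1).
  by rewrite !trace_funmx => /complexI.
have e0 i : 0 <= e 0 i by apply: psd_reigen_ge0.
have e'0 i : 0 <= e' 0 i by apply: psd_reigen_ge0.
(* The exponents agree because [s = (1 - a) / (2 a)] gives [-2 s a = a - 1]. *)
have scale i : D^-1 * pw a (D * e 0 i) = pw a (c * e 0 i).
  rewrite !pwM // mulrA; congr (_ * _).
  have powD r t : powR D (r + t) = powR D r * powR D t.
    by rewrite powRD //; apply/implyP => _; rewrite gt_eqF.
  rewrite -[D^-1]powR_inv1 ?ltW // powRM ?powR_ge0 // -!powRrM -!powD.
  by congr powR; rewrite /s; field; rewrite gt_eqF.
apply: Q_suff.
- move=> /andP[-> ns] /=; apply: contra ns => /asboolP hs.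
  by apply/asboolP/supp_le_processing.
(* If the trace for [F Z] were zero, all eigenvalues of [F Z] would vanish, hence those of [Z] by
   trace preservation, and [Q] would be zero. *)
- move=> Q0; rewrite lt_neqAle sumr_ge0 ?andbT => [|i _]; last exact: pw_ge0.
  apply: contraL Q0 => /eqP Q'0; rewrite -leNgt.
  have z' i : e' 0 i = 0.
    have hp : forall k, xpredT k -> 0 <= pw a (e' 0 k) by move=> k _; exact: pw_ge0.
    have := psumr_eq0P hp (esym Q'0); move=> /(_ i isT).
    by rewrite pw_powR // => /powR_eq0_eq0.
  rewrite big1 // => i _.
  have hp : forall k, xpredT k -> 0 <= e 0 k by [].
  have s0 : \sum_i e 0 i = 0 by rewrite -tre big1.
  have := psumr_eq0P hp s0; move=> /(_ i isT) ->.
  by rewrite mulr0 /pw ltxx.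
- move=> _; case: ltrP => [a_gt1|a_le1].
    have := trace_jensen lF pF tF F1 D0 (tangent_below_pw a_gt1) pZ.
    rewrite mulr_sumr -/e -/e'; congr (_ <= _); apply: eq_bigr => i _; exact: scale.
  have a_lt1 : 0 < a < 1 by rewrite a0 lt_neqAle a1.
  have := trace_jensen lF pF tF F1 D0 (tangent_below_oppr_pw a_lt1) pZ.
  rewrite !sumrN mulrN lerN2 mulr_sumr -/e -/e'; congr (_ <= _).
  by apply: eq_bigr => i _; exact: scale.
Qed.

Lemma sandwichedD_processing (alpha : \bar R) : (0 < alpha)%E ->
  (sandwichedD alpha (F tau) sigma' <= sandwichedD alpha tau sigma)%E.
Proof.
case: alpha => [a|_|//]; last exact: max_D_processing.
rewrite lte_fin => a0; have [->|a1] := eqVneq a 1; first exact: umegaki_D_processing.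
exact: renyi_D_processing.
Qed.

End DataProcessing.

(** * The key unitary as a permutation of basis indices *)

Lemma solve_2x2 (F : fieldType) (a b c e u v : F) : a * e - b * c != 0 ->
  (a * e - b * c)^-1 * e * (a * u + c * v) - (a * e - b * c)^-1 * c * (b * u + e * v) = u /\
  - ((a * e - b * c)^-1 * b) * (a * u + c * v) + (a * e - b * c)^-1 * a * (b * u + e * v) = v.
Proof. by move=> nz; split; field. Qed.

Lemma solve_2x2V (F : fieldType) (a b c e u v : F) : a * e - b * c != 0 ->
  a * ((a * e - b * c)^-1 * e * u - (a * e - b * c)^-1 * c * v) +
    c * (- ((a * e - b * c)^-1 * b) * u + (a * e - b * c)^-1 * a * v) = u /\
  b * ((a * e - b * c)^-1 * e * u - (a * e - b * c)^-1 * c * v) +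
    e * (- ((a * e - b * c)^-1 * b) * u + (a * e - b * c)^-1 * a * v) = v.
Proof. by move=> nz; split; field. Qed.

Section KeyUnitary.
Variable R : realType.
Local Notation C := R[i].
Local Notation toC := (real_complex R).

Section PermutationOperator.
Variables (T : finType) (m m' : T -> T).
Hypotheses (mK : cancel m m') (m'K : cancel m' m).

Local Notation U := (mkop (fun p q => if p == m q then 1 else 0) : op R T).

Lemma ent_permM X p q : ent (U *m X) p q = ent X (m' p) q.
Proof.
rewrite ent_mul (bigD1 (m' p)) //= ent_mkop m'K eqxx mul1r big1 ?addr0 // => t ne.
rewrite ent_mkop ifN ?mul0r //; apply: contra_neq ne => ->; exact/esym/mK.
Qed.

Lemma ent_adj_permM X p q : ent (adj U *m X) p q = ent X (m p) q.
Proof.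
rewrite ent_mul (bigD1 (m p)) //= ent_adj ent_mkop eqxx conjC1 mul1r.
rewrite big1 ?addr0 // => t ne; rewrite ent_adj ent_mkop ifN //.
by rewrite conjC0 mul0r.
Qed.

Lemma ent_mul_perm X p q : ent (X *m U) p q = ent X p (m q).
Proof.
rewrite ent_mul (bigD1 (m q)) //= ent_mkop eqxx mulr1.
by rewrite big1 ?addr0 // => t ne; rewrite ent_mkop ifN // mulr0.
Qed.

Lemma ent_mul_adj_perm X p q : ent (X *m adj U) p q = ent X p (m' q).
Proof.
rewrite ent_mul (bigD1 (m' q)) //= ent_adj ent_mkop m'K eqxx conjC1 mulr1.
rewrite big1 ?addr0 // => t ne; rewrite ent_adj ent_mkop ifN ?conjC0 ?mulr0 //.
by apply: contra_neq ne => ->; exact/esym/mK.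
Qed.

End PermutationOperator.

Section KeyMap.
Variables (d n : nat) (G : 'M['F_d]_2).
Hypothesis G_unit : \det G != 0.
Local Notation I := (qudits d n).
Local Notation D := (#|I|%:R : C).

Lemma det2 : \det G = G 0 0 * G 1 1 - G 0 1 * G 1 0.
Proof.
rewrite (expand_det_row _ 0) !big_ord_recl big_ord0 /cofactor !det_mx11 !mxE /=.
have -> : lift 0 (0 : 'I_1) = 1 :> 'I_2 by apply: val_inj.
have -> : lift 1 (0 : 'I_1) = 0 :> 'I_2 by apply: val_inj.
by rewrite /= expr0 expr1 mul1r mulN1r mulrN addr0.
Qed.

(** The transpose of [G] applied to the pair of registers; [keymap] applies its inverse, by Cramer's
    rule. *)
Definition keymap_inv (q : I * I) : I * I :=
  (G 0 0 *: q.1 + G 1 0 *: q.2, G 0 1 *: q.1 + G 1 1 *: q.2).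

Lemma keymapK : cancel (@keymap d n G) keymap_inv.
Proof.
move=> [u v]; rewrite /keymap_inv /keymap /=.
have := G_unit; rewrite det2; move: (G 0 0) (G 0 1) (G 1 0) (G 1 1) => a b c e nz.
by congr pair; apply/rowP => i; rewrite !mxE; have [] := solve_2x2V (u 0 i) (v 0 i) nz.
Qed.

Lemma keymap_invK : cancel keymap_inv (@keymap d n G).
Proof.
move=> [u v]; rewrite /keymap_inv /keymap /=.
have := G_unit; rewrite det2; move: (G 0 0) (G 0 1) (G 1 0) (G 1 1) => a b c e nz.
by congr pair; apply/rowP => i; rewrite !mxE; have [] := solve_2x2 (u 0 i) (v 0 i) nz.
Qed.

Lemma ent_keyE (X : op R (I * I)%type) i j :
  ent (keyE G X) i j = \sum_k ent X (keymap_inv (i, k)) (keymap_inv (j, k)).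
Proof.
rewrite ent_mkop; apply: eq_bigr => k _.
by rewrite (ent_mul_adj_perm keymapK keymap_invK) (ent_permM keymapK keymap_invK).
Qed.

Lemma ent_keyEinv (X : op R I) p q : ent (keyEinv G X) p q =
  D^-1 * (((keymap G p).2 == (keymap G q).2)%:R * ent X (keymap G p).1 (keymap G q).1).
Proof.
rewrite ent_mul_perm ent_adj_permM ent_mkop entZ ent1.
by rewrite mulrC mulrA.
Qed.

Hypotheses (G01 : G 0 1 != 0) (G10 : G 1 0 != 0).

Lemma affine_bij (a : 'F_d) (u : I) : a != 0 -> bijective (fun v : I => u + a *: v).
Proof.
move=> a0; exists (fun w => a^-1 *: (w - u)) => v.
  by rewrite addrC addKr scalerK.
by rewrite scalerA divff // scale1r addrC subrK.
Qed.

(** At equal [b], the second components of [keymap] differ by a nonzero multiple of [a - a'] because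
    [G 0 1] is nonzero. At fixed [a], the first component runs over the whole register with [b]
    because [G 1 0] is nonzero. *)
Lemma keyEinv_marginal (X : op R I) a a' :
  \sum_b ent (keyEinv G X) (a, b) (a', b) = (a == a')%:R * (D^-1 * \tr X).
Proof.
have nz01 : - ((\det G)^-1 * G 0 1) != 0 by rewrite oppr_eq0 mulf_neq0 // invr_eq0.
under eq_bigr do rewrite ent_keyEinv.
rewrite -mulr_sumr mulrCA; congr (_ * _); rewrite /keymap /=.
under eq_bigr do rewrite (inj_eq (addIr _)) (inj_eq (scalerI nz01)).
case: eqP => [<-|_]; last by rewrite mul0r big1 // => b _; rewrite mul0r.
have nz : - ((\det G)^-1 * G 1 0) != 0 by rewrite oppr_eq0 mulf_neq0 // invr_eq0.
rewrite mul1r ent_trace [RHS](reindex _ (onW_bij _ (affine_bij (((\det G)^-1 * G 1 1) *: a) nz))) /=.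
by apply: eq_bigr => b _; rewrite mul1r scaleNr.
Qed.

(** The argument of [keyEinv_marginal] for [keymap_inv]: [G 0 1] forces [i = j], and [G 1 0] makes
    the sum run over the full diagonal of [A]. *)
Lemma keyE_diag (X : op R (I * I)%type) (A : op R I) :
  (forall u v, ent X u v = (u.2 == v.2)%:R * ent A u.1 v.1) ->
  forall i j, ent (keyE G X) i j = (i == j)%:R * \tr A.
Proof.
move=> XA i j; rewrite ent_keyE.
under eq_bigr do rewrite XA /= (inj_eq (addIr _)) (inj_eq (scalerI G01)).
case: eqP => [<-|_]; last by rewrite mul0r big1 // => b _; rewrite mul0r.
rewrite mul1r ent_trace [RHS](reindex _ (onW_bij _ (affine_bij (G 0 0 *: i) G10))) /=.
by apply: eq_bigr => b _; rewrite mul1r.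
Qed.

End KeyMap.
End KeyUnitary.

(** * Maps acting on one tensor factor *)

Section Lifting.
Variable R : realType.
Local Notation C := R[i].
Implicit Types I J K T W : finType.

Lemma sum_prod I K (f : I * K -> C) : \sum_p f p = \sum_i \sum_k f (i, k).
Proof. by rewrite pair_bigA; apply: eq_bigr => -[]. Qed.

(** The case of [psd_pullback] with a single fibre; it covers relabelling of registers as well as
    restriction to a block. *)
Lemma psd_reindex I T (p : T -> I) (A : op R I) :
  psd A -> psd (mkop (fun s t => ent A (p s) (p t))).
Proof.
move=> /(psd_pullback (fun=> tt) p); congr psd; apply: entP => s t.
by rewrite !ent_mkop mul1r.
Qed.

Lemma ent_liftL I K (L : op R I -> op R I) (A : op R (I * K)%type) p q :
  ent (liftL L A) p q =
  ent (L (mkop (fun i j => ent A (i, p.2) (j, q.2)))) p.1 q.1.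
Proof. exact: ent_mkop. Qed.

Lemma ent_liftR I K (L : op R K -> op R K) (A : op R (I * K)%type) p q :
  ent (liftR L A) p q =
  ent (L (mkop (fun i j => ent A (p.1, i) (q.1, j)))) p.2 q.2.
Proof. exact: ent_mkop. Qed.

Lemma trace_liftL I K (L : op R I -> op R I) (A : op R (I * K)%type) :
  (forall B, \tr (L B) = \tr B) -> \tr (liftL L A) = \tr A.
Proof.
move=> tL; rewrite !ent_trace.
rewrite !sum_prod exchange_big [RHS]exchange_big.
apply: eq_bigr => k _ /=; under eq_bigr do rewrite ent_liftL /=.
by rewrite -ent_trace tL ent_trace; apply: eq_bigr => i _; rewrite ent_mkop.
Qed.

(** The kernel consists of the entries of [L] on matrix units. *)
Lemma op_linear_ker I J (L : op R I -> op R J) : op_linear L ->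
  exists kap : I -> I -> J -> J -> C, forall A a b,
    ent (L A) a b = \sum_i \sum_j ent A i j * kap i j a b.
Proof.
move=> lL; pose E i j : op R I := mkop (fun u v => ((u == i) && (v == j))%:R).
exists (fun i j => ent (L (E i j))) => A a b.
have {1}-> : A = \sum_(p : I * I) ent A p.1 p.2 *: E p.1 p.2.
  apply: entP => u v; rewrite ent_sum (bigD1 (u, v)) //= entZ ent_mkop !eqxx mulr1.
  rewrite big1 ?addr0 // => -[i j]; rewrite xpair_eqE entZ ent_mkop /=.
  by rewrite [i == u]eq_sym [j == v]eq_sym => /negPf ->; rewrite mulr0.
rewrite (op_linear_sum lL) ent_sum pair_bigA /=.
by apply: eq_bigr => p _; rewrite entZ.
Qed.

(** Maps on different tensor factors commute: written with kernels, this is an exchange of finite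
    sums. *)
Lemma op_linear_comm I J (L1 : op R I -> op R I) (L2 : op R J -> op R J)
    (z : I -> J -> I -> J -> C) a b a' b' :
  op_linear L1 -> op_linear L2 ->
  ent (L2 (mkop (fun j j' =>
    ent (L1 (mkop (fun i i' => z i j i' j'))) a a'))) b b' =
  ent (L1 (mkop (fun i i' =>
    ent (L2 (mkop (fun j j' => z i j i' j'))) b b'))) a a'.
Proof.
move=> /op_linear_ker[k1 e1] /op_linear_ker[k2 e2]; rewrite e1 e2.
under eq_bigr do under eq_bigr do rewrite ent_mkop e1 pair_bigA /= mulr_suml.
under [RHS]eq_bigr do under eq_bigr do rewrite ent_mkop e2 pair_bigA /= mulr_suml.
rewrite pair_bigA [RHS]pair_bigA exchange_big /=; apply: eq_bigr => p _; apply: eq_bigr => q _.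
by rewrite !ent_mkop mulrAC.
Qed.

Lemma ent_embedL T W K (h : T -> W * K) (g : W * K -> T) (X : op R K) (Y : op R T) p q :
  cancel h g -> cancel g h ->
  ent (embed h X *m Y) p q = \sum_k ent X (h p).2 k * ent Y (g ((h p).1, k)) q.
Proof.
move=> hK gK; rewrite ent_mul; under eq_bigr => t _ do rewrite ent_embed -[in ent Y _ _](hK t).
rewrite (sum_bij_pair (Bijective hK gK) (fun wk => ((h p).1 == wk.1)%:R *
   ent X (h p).2 wk.2 * ent Y (g wk) q)) /=.
rewrite (bigD1 (h p).1) //= [X in _ + X]big1 ?addr0 => [|w ne].
  by apply: eq_bigr => k _; rewrite eqxx mul1r.
by rewrite big1 // => k _; rewrite eq_sym (negPf ne) !mul0r.
Qed.

Lemma ent_embedR T W K (h : T -> W * K) (g : W * K -> T) (X : op R K) (Y : op R T) p q :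
  cancel h g -> cancel g h ->
  ent (Y *m embed h X) p q = \sum_k ent Y p (g ((h q).1, k)) * ent X k (h q).2.
Proof.
move=> hK gK; rewrite ent_mul; under eq_bigr => t _ do rewrite ent_embed -[in ent Y _ _](hK t).
rewrite (sum_bij_pair (Bijective hK gK) (fun wk => ent Y p (g wk) *
  ((wk.1 == (h q).1)%:R * ent X wk.2 (h q).2))) /=.
rewrite (bigD1 (h q).1) //= [X in _ + X]big1 ?addr0 => [|w ne].
  by apply: eq_bigr => k _; rewrite eqxx mul1r.
by rewrite big1 // => k _; rewrite (negPf ne) mul0r mulr0.
Qed.

End Lifting.

(** * Entropy of the convolution of two channels *)

Section Convolution.
Variables (R : realType) (d n : nat).
Local Notation C := R[i].
Local Notation toC := (real_complex R).
Local Notation I := (qudits d n).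
Local Notation D := (#|I|%:R : R).

Let D_gt0 : 0 < D.
Proof. by rewrite ltr0n; apply/card_gt0P; exists 0. Qed.

Let toCD : toC D = #|I|%:R.
Proof. exact: rmorph_nat. Qed.

Let toCDV : toC D^-1 = #|I|%:R^-1.
Proof. by rewrite fmorphV /= toCD. Qed.

(** * Odd parity: factoring the convolution through [L2] *)

Section OddParity.
Variables (G : 'M['F_d]_2) (L1 L2 : op R I -> op R I).
Hypotheses (G_unit : \det G != 0) (G01 : G 0 1 != 0) (G10 : G 1 0 != 0).
Hypotheses (ch1 : channel L1) (ch2 : channel L2).
Variables (k : nat) (rho : op R (I * 'I_k)%type).
Hypothesis srho : is_state rho.

Local Notation N := #|((I * 'I_k)%type : finType)|.
Local Notation T := (I * 'I_N)%type.
Local Notation minv := (keymap_inv G).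

(* The ancilla of L2 is the pair (first register A, ancilla of rho), encoded as an ordinal. *)
Definition splitT (t : T) : (I * I) * 'I_k :=
  ((t.1, (enum_val t.2).1), (enum_val t.2).2).
Definition mergeT (u : (I * I) * 'I_k) : T := (u.1.1, enum_rank (u.1.2, u.2)).

Lemma splitTK : cancel splitT mergeT.
Proof. by case=> b x; rewrite /mergeT /= -surjective_pairing enum_valK. Qed.

Lemma mergeTK : cancel mergeT splitT.
Proof. by case=> [[b a] r]; rewrite /splitT /= enum_rankK. Qed.

Let bT : bijective splitT := Bijective splitTK mergeTK.
Let bT' : bijective (@id (I * 'I_k)) := Bijective (fun=> erefl) (fun=> erefl).

(** The block of [Y] at fixed indices of register B and of the ancilla of [rho]: the operator on
    register A to which [L1] is applied. *)
Definition slice (Y : op R T) b r b' r' : op R I :=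
  mkop (fun i j => ent Y (mergeT ((b, i), r)) (mergeT ((b', j), r'))).

(* The map F of the header, tensored with the identity of 'I_k. *)
Definition post (Y : op R T) : op R (I * 'I_k)%type :=
  mkop (fun p q => ent (keyE G (liftL L1
    (mkop (fun u v => ent Y (mergeT ((u.2, u.1), p.2)) (mergeT ((v.2, v.1), q.2))))))
    p.1 q.1).

(* E^-1 tensored with the identity of 'I_k, applied to rho. *)
Definition pre : op R T :=
  mkop (fun s t => ent (keyEinv G
    (mkop (fun i j => ent rho (i, (splitT s).2) (j, (splitT t).2))))
    ((splitT s).1.2, (splitT s).1.1) ((splitT t).1.2, (splitT t).1.1)).

Definition rhoR : op R 'I_k := mkop (fun r r' => \sum_a ent rho (a, r) (a, r')).

Lemma postE Y p q : ent (post Y) p q = \sum_b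
  ent (L1 (slice Y (minv (p.1, b)).2 p.2 (minv (q.1, b)).2 q.2))
    (minv (p.1, b)).1 (minv (q.1, b)).1.
Proof.
rewrite ent_mkop ent_keyE //; apply: eq_bigr => b _; rewrite ent_liftL.
congr (ent (L1 _) _ _); apply: entP => i j; by rewrite !ent_mkop.
Qed.

Lemma post_linear : op_linear post.
Proof.
case: ch1 => l1 _ _ a A B; apply: entP => p q; rewrite [LHS]postE [RHS]entD [X in _ = X + _]entZ [X in _ = _ * X + _]postE [X in _ = _ + X]postE.
rewrite mulr_sumr -big_split /=; apply: eq_bigr => b _.
rewrite -entZ -entD -l1; congr (ent (L1 _) _ _); apply: entP => i j.
by rewrite !(entD, entZ, ent_mkop).
Qed.

(** Complete positivity of [L1], followed by a sum over the traced register of restrictions to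
    blocks. *)
Lemma post_psd Y : psd Y -> psd (post Y).
Proof.
case: ch1 => _ p1 _ pY.
(* [Y] with register A in front. Register B and the ancilla of [rho] are packed into one ordinal,
   the form of ancilla that [channel] speaks of. *)
pose Y1 : op R (I * 'I_N)%type :=
  mkop (fun s t => ent Y (mergeT (((enum_val s.2).1, s.1), (enum_val s.2).2))
                         (mergeT (((enum_val t.2).1, t.1), (enum_val t.2).2))).
have pY1 : psd (liftL L1 Y1).
  by apply: p1; exact: (psd_reindex (fun s : I * 'I_N =>
    mergeT (((enum_val s.2).1, s.1), (enum_val s.2).2))).
pose f b (p : I * 'I_k) : I * 'I_N :=
  ((minv (p.1, b)).1, enum_rank ((minv (p.1, b)).2, p.2)).
have -> : post Y = \sum_b mkop (fun p q => ent (liftL L1 Y1) (f b p) (f b q)).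
  apply: entP => p q; rewrite postE ent_sum; apply: eq_bigr => b _.
  rewrite ent_mkop ent_liftL /=; congr (ent (L1 _) _ _); apply: entP => i j.
  by rewrite !ent_mkop /= !enum_rankK.
by apply: psd_sum => b; apply: psd_reindex.
Qed.

Let sum_minv (f : I * I -> C) : \sum_u f (minv u) = \sum_u f u.
Proof.
by rewrite [RHS](reindex _ (onW_bij _ (Bijective (keymap_invK G_unit) (keymapK G_unit)))).
Qed.

(** [minv] permutes the pairs of register indices, so it drops out of the full trace; [L1] preserves
    the trace of each [slice]. *)
Lemma post_trace Y : \tr (post Y) = \tr Y.
Proof.
case: ch1 => _ _ t1; rewrite !ent_trace.
under eq_bigr do rewrite postE.
rewrite sum_prod exchange_big /=.
under eq_bigr => r _.
  rewrite -(sum_prod (fun u => ent (L1 (slice Y (minv u).2 r (minv u).2 r))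
    (minv u).1 (minv u).1)).
  rewrite (sum_minv (fun u => ent (L1 (slice Y u.2 r u.2 r)) u.1 u.1)).
  rewrite sum_prod exchange_big /=.
  under eq_bigr do rewrite -ent_trace t1 ent_trace.
  over.
have -> : \sum_t ent Y t t = \sum_t ent Y (mergeT (splitT t)) (mergeT (splitT t)).
  by apply: eq_bigr => t _; rewrite splitTK.
rewrite (sum_bij_pair bT (fun u => ent Y (mergeT u) (mergeT u))) [RHS]exchange_big /=.
apply: eq_bigr => r _; rewrite pair_bigA /=; apply: eq_bigr => -[b a] _ /=.
by rewrite ent_mkop.
Qed.

(** [L1 1] on A tensored with the identity elsewhere has the form required by [keyE_diag], and
    [L1 1] has trace [D]. *)
Lemma post1 : post 1%:M = toC D *: 1%:M.
Proof.
case: ch1 => l1 _ t1; apply: entP => p q; rewrite entZ ent1 ent_mkop.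
rewrite (keyE_diag G_unit G01 G10 (A := (p.2 == q.2)%:R *: L1 1%:M)).
  rewrite linearZ /= t1 mxtrace1 toCD mulrA -natrM mulnb mulrC.
  by rewrite [p]surjective_pairing [q]surjective_pairing.
move=> u v; rewrite ent_liftL entZ mulrA -natrM mulnb -entZ -(op_linearZ l1).
congr (ent (L1 _) _ _); apply: entP => i j; rewrite !ent_mkop entZ !ent1.
rewrite (can_eq mergeTK) -natrM mulnb !xpair_eqE.
by rewrite andbAC.
Qed.

(** The slices of the product are combinations of slices of [Y] with the entries of [s] as
    coefficients, and [L1] is linear. *)
Lemma post_mulL s Y : post (embed splitT s *m Y) = embed id s *m post Y.
Proof.
case: ch1 => l1 _ _; apply: entP => p q.
rewrite [RHS](ent_embedL (g := id)) // [LHS]postE.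
under [RHS]eq_bigr do rewrite postE mulr_sumr.
rewrite exchange_big /=; apply: eq_bigr => b _.
have -> : slice (embed splitT s *m Y) (minv (p.1, b)).2 p.2 (minv (q.1, b)).2 q.2 =
    \sum_r ent s p.2 r *: slice Y (minv (p.1, b)).2 r (minv (q.1, b)).2 q.2.
  apply: entP => i j; rewrite ent_mkop (ent_embedL _ _ _ _ splitTK mergeTK) mergeTK ent_sum.
  by apply: eq_bigr => r _; rewrite entZ ent_mkop.
rewrite (op_linear_sum l1) ent_sum; apply: eq_bigr => r _; exact: entZ.
Qed.

Lemma post_mulR s Y : post (Y *m embed splitT s) = post Y *m embed id s.
Proof.
case: ch1 => l1 _ _; apply: entP => p q.
rewrite [RHS](ent_embedR (g := id)) // [LHS]postE.
under [RHS]eq_bigr do rewrite postE mulr_suml.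
rewrite exchange_big /=; apply: eq_bigr => b _.
have -> : slice (Y *m embed splitT s) (minv (p.1, b)).2 p.2 (minv (q.1, b)).2 q.2 =
    \sum_r ent s r q.2 *: slice Y (minv (p.1, b)).2 p.2 (minv (q.1, b)).2 r.
  apply: entP => i j; rewrite ent_mkop (ent_embedR _ _ _ _ splitTK mergeTK) mergeTK ent_sum.
  by apply: eq_bigr => r _; rewrite entZ ent_mkop mulrC.
by rewrite (op_linear_sum l1) ent_sum; apply: eq_bigr => r _; rewrite entZ mulrC.
Qed.

Lemma post_pre : post (liftL L2 pre) = liftL (conv G L1 L2) rho.
Proof.
have key r r' : mkop (fun u v : I * I => ent (liftL L2 pre)
      (mergeT ((u.2, u.1), r)) (mergeT ((v.2, v.1), r'))) =
    liftR L2 (keyEinv G (mkop (fun i j => ent rho (i, r) (j, r')))).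
  apply: entP => u v; rewrite ent_mkop ent_liftL ent_liftR /=.
  congr (ent (L2 _) _ _); apply: entP => i j.
  by rewrite !ent_mkop /splitT /= !enum_rankK.
by apply: entP => p q; rewrite [LHS]ent_mkop key [RHS]ent_liftL.
Qed.

(** Up to the factor [D^-1], [pre] is [rho] pulled back along the first component of [keymap], and
    block diagonal in the second. *)
Lemma pre_psd : psd pre.
Proof.
have -> : pre = toC D^-1 *: mkop (fun s t =>
    ((keymap G ((splitT s).1.2, (splitT s).1.1)).2 ==
     (keymap G ((splitT t).1.2, (splitT t).1.1)).2)%:R *
    ent rho ((keymap G ((splitT s).1.2, (splitT s).1.1)).1, (splitT s).2)
            ((keymap G ((splitT t).1.2, (splitT t).1.1)).1, (splitT t).2)).
  apply: entP => s t; rewrite entZ !ent_mkop ent_keyEinv //.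
  by rewrite ent_mkop toCDV.
apply: psdZ; first by rewrite invr_ge0 ltW.
exact: (psd_pullback (fun s => (keymap G ((splitT s).1.2, (splitT s).1.1)).2)
  (fun s => ((keymap G ((splitT s).1.2, (splitT s).1.1)).1, (splitT s).2)) srho.1).
Qed.

Lemma pre_marginal x y : \sum_b ent pre (b, x) (b, y) =
  ((enum_val x).1 == (enum_val y).1)%:R * (toC D^-1 * ent rhoR (enum_val x).2 (enum_val y).2).
Proof.
under eq_bigr do rewrite ent_mkop /splitT /=.
rewrite (keyEinv_marginal G_unit G01 G10) ent_trace ent_mkop.
rewrite toCDV; congr (_ * (_ * _)).
by apply: eq_bigr => a _; rewrite ent_mkop.
Qed.

Lemma pre_trace : \tr pre = 1.
Proof.
rewrite ent_trace sum_prod exchange_big /=.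
under eq_bigr do rewrite pre_marginal eqxx mul1r.
rewrite (reindex (@enum_rank (I * 'I_k)%type)) /=; last exact: onW_bij (enum_rank_bij _).
under eq_bigr do rewrite enum_rankK.
rewrite sum_prod /= sumr_const.
rewrite -mulr_sumr -[LHS]mulr_natl mulrA -toCD -rmorphM divff ?gt_eqF // mul1r.
under eq_bigr do rewrite ent_mkop.
rewrite exchange_big pair_bigA /=; under eq_bigr do rewrite -surjective_pairing.
by rewrite -ent_trace; exact: srho.2.
Qed.

Lemma rhoR_psd : psd rhoR.
Proof.
have -> : rhoR = \sum_a mkop (fun r r' => ent rho (a, r) (a, r')).
  by apply: entP => r r'; rewrite ent_mkop ent_sum; apply: eq_bigr => a _; rewrite ent_mkop.
by apply: psd_sum => a; exact: (psd_reindex (fun r : 'I_k => (a, r)) srho.1).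
Qed.

Lemma replacer_rho : liftL (@replacer R I) rho = embed id (toC D^-1 *: rhoR).
Proof.
apply: entP => p q; rewrite ent_liftL /replacer entZ ent1 ent_embed entZ ent_mkop.
rewrite toCDV ent_trace mulrC; congr (_ * _); rewrite mulrC.
by congr (_ * _); apply: eq_bigr => a _; rewrite ent_mkop.
Qed.

(** One factor [D^-1] comes from the replacer on B, the other from the maximally mixed marginal of
    [pre] on A. *)
Lemma replacer_pre :
  liftL (@replacer R I) pre = embed splitT (toC D^-1 *: (toC D^-1 *: rhoR)).
Proof.
apply: entP => p q; rewrite ent_liftL /replacer entZ ent1 ent_embed !entZ ent_trace.
under eq_bigr do rewrite ent_mkop.
rewrite pre_marginal /splitT /= xpair_eqE -mulnb natrM toCDV.
by rewrite mulrC -!mulrA; congr (_ * (_ * (_ * _))); exact: mulrC.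
Qed.

(** Data processing under [post], with [x] equal to [D^-1] times [rhoR] and [tau] the image of [pre]
    under [L2]. *)
Lemma sandwichedD_conv (alpha : \bar R) : (0 < alpha)%E ->
  (sandwichedD alpha (liftL (conv G L1 L2) rho) (liftL (@replacer R I) rho) <=
   sandwichedD alpha (liftL L2 pre) (liftL (@replacer R I) pre))%E.
Proof.
move=> a0; rewrite -post_pre replacer_rho replacer_pre.
have [l2 p2 t2] := ch2.
apply: (sandwichedD_processing bT bT' D_gt0) => //.
- by apply: psdZ rhoR_psd; rewrite invr_ge0 ltW.
- by apply: p2; exact: pre_psd.
- by rewrite trace_liftL // pre_trace.
- exact: post_linear.
- exact: post_psd.
- exact: post_trace.
- exact: post1.
- by move=> s t A; rewrite post_mulR post_mulL.
Qed.

End OddParity.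

(** * From states to channels, and the even parity case *)

Lemma chanD_conv_odd (G : 'M['F_d]_2) (L1 L2 : op R I -> op R I) (alpha : \bar R) :
  \det G != 0 -> G 0 1 != 0 -> G 1 0 != 0 -> channel L1 -> channel L2 -> (0 < alpha)%E ->
  (chanD alpha (conv G L1 L2) (@replacer R I) <= chanD alpha L2 (@replacer R I))%E.
Proof.
move=> G_unit G01 G10 ch1 ch2 a0.
apply: ge_ereal_sup => _ [k [rho [srho ->]]].
apply: (le_trans (sandwichedD_conv G_unit G01 G10 ch1 ch2 srho a0)).
apply: ereal_sup_ubound; exists #|((I * 'I_k)%type : finType)|, (pre G rho); split=> //.
by split; [exact: pre_psd | exact: pre_trace].
Qed.

Lemma chanH_conv_odd (G : 'M['F_d]_2) (L1 L2 : op R I -> op R I) (alpha : \bar R) :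
  \det G != 0 -> G 0 1 != 0 -> G 1 0 != 0 -> channel L1 -> channel L2 ->
  (0 < alpha)%E -> (chanH alpha L2 <= chanH alpha (conv G L1 L2))%E.
Proof.
move=> G_unit G01 G10 ch1 ch2 a0.
have := chanD_conv_odd G_unit G01 G10 ch1 ch2 a0; rewrite /chanH.
move: (chanD _ _ _) (chanD _ _ _) => x y xy.
by apply: leeD2l; rewrite leeN2.
Qed.

Lemma opp_inv_mul (F : fieldType) (x y : F) : (- x)^-1 * y = - (x^-1 * y).
Proof. by rewrite invrN mulNr. Qed.

Lemma det_xcol2 (G : 'M['F_d]_2) : \det (xcol 0 1 G) = - \det G.
Proof. by rewrite !det2 !mxE !tpermL !tpermR; ring. Qed.

(** Exchanging the columns swaps the two components of [keymap_inv]; in [keymap] the sign of the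
    determinant compensates the signs of the coefficients. *)
Lemma conv_xcol (G : 'M['F_d]_2) (L1 L2 : op R I -> op R I) :
  \det G != 0 -> channel L1 -> channel L2 ->
  conv (xcol 0 1 G) L2 L1 = conv G L1 L2.
Proof.
move=> G_unit [l1 _ _] [l2 _ _]; set G' := xcol 0 1 G.
have G'0 i : G' i 0 = G i 1 by rewrite mxE tpermL.
have G'1 i : G' i 1 = G i 0 by rewrite mxE tpermR.
have detG' : \det G' = - \det G by exact: det_xcol2.
clearbody G'.
have G'_unit : \det G' != 0 by rewrite detG' oppr_eq0.
have swap_keymap (q : I * I) : keymap G' (q.2, q.1) = keymap G q.
  rewrite /keymap detG' !G'0 !G'1 !opp_inv_mul.
  apply: congr2; first by rewrite !scaleNr opprK addrC.
  by rewrite opprK addrC.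
have swap_inv (q : I * I) : keymap_inv G' q = ((keymap_inv G q).2, (keymap_inv G q).1).
  by rewrite /keymap_inv !G'0 !G'1.
apply: functional_extensionality_dep => rho; apply: entP => i j.
rewrite /conv [LHS](ent_keyE G'_unit) [RHS](ent_keyE G_unit); apply: eq_bigr => b _; rewrite !swap_inv.
move: (keymap_inv G (i, b)) (keymap_inv G (j, b)) => u v.
rewrite [LHS]ent_liftL [RHS]ent_liftL /=.
(* With the registers swapped back, the two sides differ only in the order in which [L1] and [L2]
   are applied. *)
transitivity (ent (L2 (mkop (fun k k' => ent (L1 (mkop (fun l l' =>
    ent (keyEinv G rho) (l, k) (l', k')))) u.1 v.1))) u.2 v.2).
  congr (ent (L2 _) _ _); apply: entP => k k'; rewrite [LHS]ent_mkop ent_liftR [RHS]ent_mkop /=.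
  congr (ent (L1 _) _ _); apply: entP => l l'; rewrite [LHS]ent_mkop [RHS]ent_mkop.
  by rewrite [LHS]ent_keyEinv // [RHS]ent_keyEinv // -!swap_keymap.
rewrite (op_linear_comm (fun l k l' k' => ent (keyEinv G rho) (l, k) (l', k')) _ _ _ _ l1 l2).
congr (ent (L1 _) _ _); apply: entP => k k'.
by rewrite [LHS]ent_mkop [RHS]ent_mkop ent_liftR.
Qed.

(** After the exchange, [G 0 0] and [G 1 1] are the off-diagonal entries and [L1] takes the second
    place. *)
Lemma chanH_conv_even (G : 'M['F_d]_2) (L1 L2 : op R I -> op R I) (alpha : \bar R) :
  \det G != 0 -> G 0 0 != 0 -> G 1 1 != 0 -> channel L1 -> channel L2 ->
  (0 < alpha)%E -> (chanH alpha L1 <= chanH alpha (conv G L1 L2))%E.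
Proof.
move=> G_unit G00 G11 ch1 ch2 a0; rewrite -(conv_xcol G_unit ch1 ch2).
have G'_unit : \det (xcol 0 1 G) != 0 by rewrite det_xcol2 oppr_eq0.
have G'01 : xcol 0 1 G 0 1 != 0 by rewrite mxE tpermR.
have G'10 : xcol 0 1 G 1 0 != 0 by rewrite mxE tpermL.
exact: (@chanH_conv_odd (xcol 0 1 G) L2 L1 alpha G'_unit G'01 G'10 ch2 ch1 a0).
Qed.

End Convolution.

Theorem mainTheorem20 (R : realType) (d n : nat) (G : 'M['F_d]_2)
  (alpha : \bar R) (L1 L2 : op R (qudits d n) -> op R (qudits d n)) :
  prime d -> (1 <= n)%N -> \det G != 0 ->
  ((1 / 2 : R)%:E <= alpha)%E ->
  channel L1 -> channel L2 ->
  [/\ odd_parity_positive G ->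
        (chanH alpha L2 <= chanH alpha (conv G L1 L2))%E,
      even_parity_positive G ->
        (chanH alpha L1 <= chanH alpha (conv G L1 L2))%E
    & positiveG G ->
        (maxe (chanH alpha L1) (chanH alpha L2)
           <= chanH alpha (conv G L1 L2))%E].
Proof.
move=> _ _ G_unit ha ch1 ch2.
have a0 : (0 < alpha)%E by apply: lt_le_trans ha; rewrite lte_fin divr_gt0.
have odd : odd_parity_positive G -> (chanH alpha L2 <= chanH alpha (conv G L1 L2))%E.
  by case/and3P => _ G01 G10; apply: chanH_conv_odd.
have even : even_parity_positive G -> (chanH alpha L1 <= chanH alpha (conv G L1 L2))%E.
  by case/and3P => _ G00 G11; apply: chanH_conv_even.
split; [exact: odd | exact: even | case/andP => /odd h2 /even h1].
by rewrite ge_max; apply/andP; split; [exact: h1 | exact: h2].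
Qed.
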